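(* Let $G$ be a graph with $n$ vertices and $m\ge 1$ edges, and let $r$ be an integer such that one of the following holds: (a) $r\in\{2,3\}$ and $\chi(G)\le r$; (b) $r=4$ and $G$ is planar. Then \[ -\frac{m}{\binom{\chi(G)}{2}\,\theta(G)}\le -\frac{2^{r+1}m^r}{r\,n^{2r-1}}. \]
   Context: All graphs are finite and simple. $\chi(G)$ is the chromatic number and $\alpha(G)$ the independence number of $G$; for a graph on $n$ vertices, $\theta(G)=\min\{n/2,\alpha(G)\}$. (In each case $G$ is $K_{r+1}$-free, so the right-hand side is Nikiforov's upper bound for the smallest adjacency eigenvalue of a $K_{r+1}$-free graph.) *)

(* Defs.v *)
From HB Require Import structures.
From mathcomp Require Import all_boot all_order all_algebra.
From mathcomp Require Import all_classical all_reals all_analysis.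
Set Implicit Arguments. Unset Strict Implicit. Unset Printing Implicit Defensive.
Import Order.TTheory GRing.Theory Num.Theory numFieldNormedType.Exports.

(* A finite simple graph: vertex set T (a finType), adjacency e : rel T,
   assumed symmetric and irreflexive (hypotheses of the theorem). *)

Definition nverts (T : finType) : nat := #|T|.

Definition nedges (T : finType) (e : rel T) : nat :=
  #|[set E : {set T} | [exists x, exists y, e x y && (E == [set x; y]%SET)]]%SET|.

Definition colorableb (T : finType) (e : rel T) (k : nat) : bool :=
  [exists f : {ffun T -> 'I_k}, [forall x, forall y, e x y ==> (f x != f y)]].

(* Chromatic number: least k (k <= #|T| always works) with a proper k-colouring. *)
Definition chromatic_number (T : finType) (e : rel T) : nat :=
  \big[minn/#|T|]_(k < #|T|.+1 | colorableb e k) (k : nat).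

Definition independentb (T : finType) (e : rel T) (S : {set T}) : bool :=
  [forall x in S, forall y in S, ~~ e x y].

Definition independence_number (T : finType) (e : rel T) : nat :=
  \max_(S : {set T} | independentb e S) #|S|.

Local Open Scope ring_scope.

Definition theta (R : realType) (T : finType) (e : rel T) : R :=
  Num.min ((nverts T)%:R / 2) (independence_number e)%:R.

Definition planar (R : realType) (T : finType) (e : rel T) : Prop :=
  exists (p : T -> R * R) (f : T -> T -> R -> R * R),
    injective p /\
    (forall x y, e x y ->
       [/\ f x y 0 = p x, f x y 1 = p y,
           {within `[(0:R), 1], continuous (f x y)}%classic,
           (forall s t : R, 0 <= s <= 1 -> 0 <= t <= 1 -> f x y s = f x y t -> s = t)
         & (forall z (t : R), 0 < t < 1 -> f x y t <> p z)]) /\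
    (forall x y u v, e x y -> e u v ->
       ~~ (((x == u) && (y == v)) || ((x == v) && (y == u))) ->
       forall s t : R, 0 < s < 1 -> 0 < t < 1 -> f x y s <> f u v t).

(* Main.v *)
(* A topological plane drawing can be sampled into polygonal arcs such that arcs of
   vertex-disjoint edges stay disjoint, and this weaker kind of drawing passes to edge
   contractions by concatenating arcs. K5 has none: counting modulo 2 how often vertical rays
   from the vertices meet the arcs, disjointness of two arcs is a linear equation over F_2,
   and the 15 equations add up to 0 = 1. A minimal counterexample argument then gives
   m <= 3n - 6. Together with chi + alpha <= n + 1, and with the clique left when equality
   holds there, this yields the inequality for planar graphs without any bound on chi.
   For 3-colourable graphs it follows from Turan's bound 3m <= n^2, for bipartite ones from
   2m <= n^2. *)
Require Import Defs.
From HB Require Import structures.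
From mathcomp Require Import all_boot all_order all_algebra.
From mathcomp Require Import zify ring lra.
Set Implicit Arguments. Unset Strict Implicit. Unset Printing Implicit Defensive.
Import Order.TTheory GRing.Theory Num.Theory.

Local Open Scope ring_scope.

(** * Segments and polygonal arcs in the plane *)

Definition segment (R : realFieldType) (a b q : R * R) : Prop :=
  exists2 l : R, 0 <= l <= 1 &
    q = (a.1 + l * (b.1 - a.1), a.2 + l * (b.2 - a.2)).

(** The starting point stays outside the list, so that consecutive arcs are joined by concatenating
    lists, without repeating the common end. *)
Fixpoint polygon (R : realFieldType) (x : R * R) (s : seq (R * R)) (q : R * R) : Prop :=
  if s is y :: s' then segment x y q \/ polygon y s' q else q = x.

Lemma segment_left (R : realFieldType) (a b : R * R) : segment a b a.
Proof. by exists 0; [lra | rewrite !mul0r !addr0; case: a]. Qed.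

Lemma segment_right (R : realFieldType) (a b : R * R) : segment a b b.
Proof. by exists 1; [lra | rewrite !mul1r ![_ + (_ - _)]addrC !subrK; case: b]. Qed.

Lemma polygon_mem (R : realFieldType) (x : R * R) s q :
  q \in x :: s -> polygon x s q.
Proof.
elim: s x => [|y s IHs] x /=; first by rewrite inE => /eqP.
rewrite inE => /predU1P[->|/IHs]; last by right.
by left; exact: segment_left.
Qed.

Lemma polygon_cat (R : realFieldType) (x : R * R) s t q :
  polygon x (s ++ t) q -> polygon x s q \/ polygon (last x s) t q.
Proof.
elim: s x => [|y s IHs] x /=; first by right.
by case=> [xyq|/IHs[ysq|tq]]; [left; left|left; right|right].
Qed.

Definition disjoint_polygons (R : realFieldType) (x : R * R) s (u : R * R) t : Prop :=
  forall q, polygon x s q -> ~ polygon u t q.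

(** * Crossing parity of disjoint polygons *)

Section Parity.
Variables (R : realFieldType) (eps : R).
Implicit Types a b c d q : R * R.

(* A generic [eps] gives distinct abscissae to finitely many points. *)
Definition absc a : R := a.1 + eps * a.2.
Local Notation X := (absc).

(** The cross product of [b - a] and [q - a], unchanged by the shear; if [X a < X b], it is positive
    exactly when [q] lies above the line [a b]. *)
Definition orient a b q : R :=
  (X b - X a) * (q.2 - a.2) - (b.2 - a.2) * (X q - X a).

(* The vertical ray up from [q] meets the half-open segment [a b]. *)
Definition above a b q : bool :=
  ((X a < X q) (+) (X b < X q)) && ((X a < X b) (+) (0 < orient a b q)).

(** For distinct abscissae: exactly one of [a], [b] lies between [c] and [d]. As a sum over F_2 it
    telescopes along a path. *)
Definition interlace a b c d : bool :=
  (X a < X c) (+) (X a < X d) (+) (X b < X c) (+) (X b < X d).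

Lemma orient0_segment a b q :
  X a < X b -> X a <= X q <= X b -> orient a b q = 0 -> segment a b q.
Proof.
rewrite /orient => ltab /andP[leaq leqb] o0.
have nz : X b - X a != 0 by lra.
have [l l01 lE] : exists2 l, 0 <= l <= 1 & l * (X b - X a) = X q - X a.
  exists ((X q - X a) / (X b - X a)); last by rewrite divfK.
  by rewrite divr_ge0 ?ler_pdivrMr /= ?mul1r; lra.
have Yq : q.2 = a.2 + l * (b.2 - a.2).
  by apply: (mulfI nz); rewrite mulrDr mulrCA mulrA lE; lra.
exists l => //; rewrite -Yq [q in LHS]surjective_pairing; congr pair.
by move: lE (congr1 (fun z => eps * z) Yq); rewrite /absc; lra.
Qed.

(** The weight is the zero of the affine function going from [A] at 0 to [B] at 1. *)
Lemma opp_sign_weight (A B : R) : A * B <= 0 -> A != B ->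
  exists2 l, 0 <= l <= 1 & l * (A - B) = A.
Proof.
move=> le0 neAB; have nz : A - B != 0 by rewrite subr_eq0.
exists (A / (A - B)); last by rewrite divfK.
have sAB : (0 <= A /\ B <= 0) \/ (A <= 0 /\ 0 <= B).
  by case: (ltrP 0 A) => A0; case: (ltrP 0 B) => B0; [nra|left; lra|right; lra|nra].
have [AB0|AB0] := ltrP 0 (A - B).
  by rewrite ler_pdivrMr // ?mul1r divr_ge0 ?(ltW AB0) //=; lra.
have AB1 : A - B < 0 by rewrite lt_neqAle nz.
rewrite ler_ndivrMr // mul1r; apply/andP; split; last by lra.
by rewrite mulr_le0 ?invr_le0 //; lra.
Qed.

(** Along [c d] the orientation with respect to [a b] is affine, so it vanishes somewhere; that
    point has its abscissa in the range of [a b] and hence lies on this segment. *)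
Lemma orient_opp_sign_meet a b c d :
  X a < X b -> X a <= X c <= X b -> X a <= X d <= X b ->
  orient a b c * orient a b d <= 0 ->
  exists2 q, segment a b q & segment c d q.
Proof.
move=> ltab ac ad le0.
have [eqo|neo] := eqVneq (orient a b c) (orient a b d).
  exists c; last exact: segment_left.
  apply: orient0_segment => //; apply/eqP; rewrite -sqrf_eq0 expr2.
  by rewrite eq_le {1}eqo mulrC le0 -expr2 sqr_ge0.
have [l l01 lE] := opp_sign_weight le0 neo.
pose q : R * R := (c.1 + l * (d.1 - c.1), c.2 + l * (d.2 - c.2)).
have Xq : X q = X c + l * (X d - X c) by rewrite /absc /=; lra.
exists q; last by exists l.
apply: orient0_segment => //; first by rewrite Xq; nra.
move: lE; rewrite /orient Xq /=; lra.
Qed.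

Lemma segment_sym a b q : segment a b q -> segment b a q.
Proof.
case=> l l01 ->; exists (1 - l); first lra.
by congr pair; lra.
Qed.

(** The two side tests can differ only when the orientation is 0 and [q] is in the abscissa range,
    which puts [q] on the segment. *)
Lemma above_swap a b q : ~ segment a b q -> above a b q = above b a q.
Proof.
wlog ltab : a b / X a < X b.
  move=> IH nseg; case: (ltgtP (X a) (X b)) => [lt|gt|eqX].
  - exact: IH.
  - by rewrite (IH b a) // => /segment_sym.
  - by rewrite /above eqX addbb.
move=> nseg; rewrite /above ltab (lt_gtF ltab) addTb addFb [(X b < _) (+) _]addbC.
case: (ltrP (X a) (X q)) => aq; case: (ltrP (X b) (X q)) => bq //=; last by lra.
rewrite -leNgt; apply/idP/idP => o; last by move: o; rewrite /orient; lra.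
rewrite lt_neqAle; apply/andP; split; last by move: o; rewrite /orient; lra.
apply/eqP => o0; apply: nseg; apply: orient0_segment; [lra|lra|].
by move: o0; rewrite /orient; lra.
Qed.

Lemma interlace_swapl a b c d : interlace b a c d = interlace a b c d.
Proof. by rewrite /interlace; case: (X a < X c) (X a < X d) (X b < X c) (X b < X d) => [] [] [] []. Qed.

Lemma interlace_swapr a b c d : interlace a b d c = interlace a b c d.
Proof. by rewrite /interlace; case: (X a < X c) (X a < X d) (X b < X c) (X b < X d) => [] [] [] []. Qed.

Lemma interlace_sym a b c d : X a != X c -> X a != X d -> X b != X c -> X b != X d ->
  interlace c d a b = interlace a b c d.
Proof. by rewrite /interlace; case: ltgtP => // _; case: ltgtP => // _; case: ltgtP => // _; case: ltgtP. Qed.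

(** By symmetry [a] may be taken leftmost. The abscissa ranges are then disjoint, or they overlap,
    or that of [c d] lies inside that of [a b]; in the last two cases disjointness of the segments
    ties the side tests together. *)
Lemma segment_parity a b c d :
  (forall q, segment a b q -> ~ segment c d q) ->
  X a != X c -> X a != X d -> X b != X c -> X b != X d ->
  above a b c (+) above a b d (+) (above c d a (+) above c d b) = interlace a b c d.
Proof.
move=> dis.
wlog leab : a b dis / X a <= X b.
  move=> IH nac nad nbc nbd; case: (leP (X a) (X b)) => [/IH->//|/ltW leba].
  rewrite (@above_swap a b c); [rewrite (@above_swap a b d)|].
  - rewrite -interlace_swapl [above c d a (+) _]addbC.
    by apply: IH => // q /segment_sym; apply: dis.
  - by move=> /dis; apply; exact: segment_right.
  - by move=> /dis; apply; exact: segment_left.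
wlog lecd : c d dis / X c <= X d.
  move=> IH nac nad nbc nbd; case: (leP (X c) (X d)) => [/IH->//|/ltW ledc].
  rewrite (@above_swap c d a); [rewrite (@above_swap c d b)|].
  - rewrite -interlace_swapr [above a b c (+) _]addbC.
    by apply: IH => // q abq /segment_sym; apply: dis.
  - by apply: dis; exact: segment_right.
  - by apply: dis; exact: segment_left.
wlog ltac : a b c d dis leab lecd / X a < X c.
  move=> IH nac nad nbc nbd; case: (ltgtP (X a) (X c)) => [/IH->//|ltca|eqac]; last by rewrite eqac eqxx in nac.
  rewrite addbC -interlace_sym //.
  by apply: IH => //; first (by move=> q cd /dis); rewrite eq_sym.
move=> nac nad nbc nbd.
have ltad : X a < X d by lra.
have [ltca leda] : ((X c < X a) = false) /\ ((X d < X a) = false) by split; apply/negbTE; lra.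
rewrite {3}/above ltca leda /= /interlace ltac ltad /=.
case: (ltP (X b) (X c)) => ltbc.
  have ltbd : X b < X d by lra.
  rewrite /above ltac ltad ltbc ltbd /=.
  by have [-> ->] : ((X c < X b) = false) /\ ((X d < X b) = false) by split; apply/negbTE; lra.
have ltcb : X c < X b by lra.
have ltab : X a < X b by lra.
(* With overlapping ranges, exactly one must hold: [c] is below [a b], or [b] is below [c d]. *)
case: (ltP (X b) (X d)) => ltbd.
  have ltcd : X c < X d by lra.
  rewrite /above ltac ltad ltbd ltab ltcb ltcd (lt_gtF ltcb) (lt_gtF ltbd) /= addbF.
  have nz : X d - X c != 0 by lra.
  pose l := (X b - X c) / (X d - X c).
  have lE : l * (X d - X c) = X b - X c by rewrite divfK.
  have l01 : 0 <= l <= 1 by rewrite divr_ge0 ?ler_pdivrMr /= ?mul1r; lra.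
  (* the point of [c d] above or below [b] *)
  pose b' : R * R := (c.1 + l * (d.1 - c.1), c.2 + l * (d.2 - c.2)).
  have Xb' : X b' = X b by move: lE; rewrite /absc /=; lra.
  (* Up to positive factors both orientations measure the height difference of [b] and [b'], with
     opposite signs. *)
  have oE : (X d - X c) * orient a b b' = - ((X b - X a) * orient c d b).
    by move: lE; rewrite /orient Xb' /=; nra.
  (* Otherwise [a b] would meet the part of [c d] from [c] to [b']; parameter [k] on that part is
     [k * l] on [c d]. *)
  have : ~ orient a b c * orient a b b' <= 0.
    move=> /orient_opp_sign_meet[]; rewrite ?Xb'; [lra|lra|lra|].
    move=> q abq [k k01 qE]; apply: (dis q) => //.
    by exists (k * l); [nra|rewrite qE /=; congr pair; lra].
  have dc0 : 0 < X d - X c by lra.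
  have ba0 : 0 < X b - X a by lra.
  case: (ltrP 0 (orient a b c)) => abc; case: (ltrP 0 (orient c d b)) => cdb //= [].
    by rewrite pmulr_rle0 // -(pmulr_rle0 _ dc0) oE oppr_le0 mulr_ge0 // ltW.
  by rewrite mulr_le0_ge0 // -(pmulr_rge0 _ dc0) oE oppr_ge0 pmulr_rle0.
(* The range of [c d] is inside that of [a b], so [c] and [d] must be on the same side of [a b]. *)
have ltdb : X d < X b by lra.
rewrite /above ltac ltad ltab (lt_gtF ltcb) (lt_gtF ltdb) ltcb ltdb /= addbF.
have : ~ orient a b c * orient a b d <= 0.
  by move=> /orient_opp_sign_meet[|||q abq cdq]; [lra|lra|lra|exact: (dis q)].
case: (ltrP 0 (orient a b c)) => abc; case: (ltrP 0 (orient a b d)) => abd //= [];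
  by nra.
Qed.

Fixpoint above_path a (s : seq (R * R)) q : bool :=
  if s is b :: s' then above a b q (+) above_path b s' q else false.

(** This sums [segment_parity] over the segments of the path; over F_2 the terms at inner vertices
    cancel. *)
Lemma segment_path_parity a b u t :
  (forall q, segment a b q -> ~ polygon u t q) ->
  (forall c, c \in u :: t -> X a != X c /\ X b != X c) ->
  above a b u (+) above a b (last u t) (+) (above_path u t a (+) above_path u t b)
    = interlace a b u (last u t).
Proof.
elim: t u => [|v t IHt] u dis ne /=.
  by rewrite addbb /interlace; case: (X a < X u) (X b < X u) => [] [].
have [nau nbu] : X a != X u /\ X b != X u by apply: ne; rewrite inE eqxx.
have [nav nbv] : X a != X v /\ X b != X v by apply: ne; rewrite !inE eqxx orbT.
have := @segment_parity a b u v; move=> /(_ _ nau nav nbu nbv) seg.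
have {}seg := seg (fun q abq uvq => dis q abq (or_introl uvq)).
have {IHt} := IHt v (fun q abq vtq => dis q abq (or_intror vtq)).
move=> /(_ (fun c cvt => ne c (mem_behead (cvt : c \in behead (u :: v :: t))))).
move: seg; rewrite /interlace.
case: (above a b u) (above a b v) (above u v a) (above u v b) => [] [] [] [];
case: (above a b _) (above_path v t a) (above_path v t b) => [] [] [];
case: (X a < X u) (X a < X v) (X b < X u) (X b < X v) => [] [] [] [] //= _;
by case: (X a < _) (X b < _) => [] [].
Qed.

(** The same cancellation along the first path. Disjointness becomes a linear equation over F_2
    whose right side depends only on the order of the end abscissae. *)
Lemma path_parity x s u t :
  disjoint_polygons x s u t ->
  (forall a c, a \in x :: s -> c \in u :: t -> X a != X c) ->
  above_path x s u (+) above_path x s (last u t)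
    (+) (above_path u t x (+) above_path u t (last x s))
  = interlace x (last x s) u (last u t).
Proof.
elim: s x => [|y s IHs] x dis ne /=.
  by rewrite addbb /interlace; case: (X x < X u) (X x < X (last u t)) => [] [].
have seg : above x y u (+) above x y (last u t)
    (+) (above_path u t x (+) above_path u t y) = interlace x y u (last u t).
  apply: segment_path_parity => [q xyq|c cut]; first by apply: dis; left.
  by split; apply: ne; rewrite // !inE eqxx ?orbT.
have {IHs} := IHs y (fun q ysq => dis q (or_intror ysq)).
move=> /(_ (fun a c ays => ne a c (mem_behead (ays : a \in behead (x :: y :: s))))).
move: seg; rewrite /interlace.
case: (above x y u) (above x y (last u t)) (above_path u t x) (above_path u t y) => [] [] [] [];
case: (above_path y s u) (above_path y s (last u t)) (above_path u t (last y s)) => [] [] [];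
case: (X x < X u) (X x < X (last u t)) (X y < X u) (X y < X (last u t)) => [] [] [] [] //= _;
by case: (X (last y s) < X u) (X (last y s) < X (last u t)) => [] [].
Qed.

End Parity.

(** * Generic abscissae, and the impossibility of drawing K5 *)

Lemma finite_fresh (R : realFieldType) (s : seq R) : exists c, c \notin s.
Proof.
pose S := \sum_(x <- s) `|x|; exists (1 + S); apply/negP => cs.
have : `|1 + S| <= S by rewrite {2}/S (big_rem (1 + S)) //= lerDl sumr_ge0.
by have := ler_norm (1 + S); lra.
Qed.

(** Two points of different ordinates collide for a single [eps], so avoiding a finite list
    suffices; points of equal ordinate are told apart by their first coordinates for every [eps]. *)
Lemma separating_abscissa (R : realFieldType) (s : seq (R * R)) :
  exists eps, {in s &, injective (absc eps)}.
Proof.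
have [eps epsN] := finite_fresh
  [seq (b.1 - a.1) / (a.2 - b.2) | a <- s, b <- s].
exists eps => a b sa sb; rewrite /absc => eqX.
case: (eqVneq a.2 b.2) => [eq2|ne2].
  by move: eqX; rewrite eq2 => /addIr eq1; rewrite [a]surjective_pairing eq1 eq2 -surjective_pairing.
case/negP: epsN; apply/allpairsP; exists (a, b); split => //=.
apply: (@mulIf _ (a.2 - b.2)); first by rewrite subr_eq0.
by rewrite divfK ?subr_eq0 //; lra.
Qed.

(* Summed over the 15 pairs of disjoint edges of K5, every [h i j k] occurs twice, every
   [{o i k, o k i}] six times, and the number of inverted [o] is odd. *)
Lemma K5_parity_absurd (h : nat -> nat -> nat -> bool) (o : nat -> nat -> bool) :
  (forall i j, (i < j < 5)%N -> o j i = ~~ o i j) ->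
  (forall i j k l, (j < 5)%N -> (l < 5)%N -> (i < j)%N -> (k < l)%N ->
    uniq [:: i; j; k; l] ->
    h i j k (+) h i j l (+) (h k l i (+) h k l j)
    = o i k (+) o i l (+) o j k (+) o j l) -> False.
Proof.
move=> oN H.
(* Booleans become naturals and each equation over F_2 the evenness of a sum, so that the
   contradiction is one of linear integer arithmetic. *)
have [h' h'E] : exists h' : nat -> nat -> nat -> nat, forall i j k, h' i j k = h i j k by exists h.
have [o' o'E] : exists o' : nat -> nat -> nat, forall i j, o' i j = o i j by exists o.
have {}oN i j : (i < j < 5)%N -> (o' i j + o' j i = 1)%N.
  by rewrite !o'E => /oN->; case: (o i j).
have {}H i j k l : (j < 5)%N -> (l < 5)%N -> (i < j)%N -> (k < l)%N ->
    uniq [:: i; j; k; l] -> exists m,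
    (h' i j k + h' i j l + h' k l i + h' k l j + o' i k + o' i l + o' j k + o' j l = m * 2)%N.
  move=> j5 l5 ij kl u; rewrite !h'E !o'E; move: (H i j k l j5 l5 ij kl u).
  set S := (X in exists m, X = _); move=> E; exists S./2; rewrite muln2; move: E.
  rewrite {}/S; do 4 case: (h _ _ _); by do 4 case: (o _ _).
have := oN 0%N 1%N; have := oN 0%N 2%N; have := oN 0%N 3%N; have := oN 0%N 4%N.
have := oN 1%N 2%N; have := oN 1%N 3%N; have := oN 1%N 4%N.
have := oN 2%N 3%N; have := oN 2%N 4%N; have := oN 3%N 4%N.
do 10 move=> /(_ isT) ?.
have := H 0%N 1%N 2%N 3%N; have := H 0%N 1%N 2%N 4%N; have := H 0%N 1%N 3%N 4%N.
have := H 0%N 2%N 1%N 3%N; have := H 0%N 2%N 1%N 4%N; have := H 0%N 2%N 3%N 4%N.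
have := H 0%N 3%N 1%N 2%N; have := H 0%N 3%N 1%N 4%N; have := H 0%N 3%N 2%N 4%N.
have := H 0%N 4%N 1%N 2%N; have := H 0%N 4%N 1%N 3%N; have := H 0%N 4%N 2%N 3%N.
have := H 1%N 2%N 3%N 4%N; have := H 1%N 3%N 2%N 4%N; have := H 1%N 4%N 2%N 3%N.
do 15 move=> /(_ isT isT isT isT isT)[? ?].
clear H oN h'E o'E; lia.
Qed.

(** After a generic shear, [path_parity] turns the disjointness of arcs into the equations refuted
    by [K5_parity_absurd]. *)
Lemma K5_polygons_meet (R : realFieldType) (p : nat -> R * R) (g : nat -> nat -> seq (R * R)) :
  {in gtn 5 &, injective p} ->
  (forall i j, (i < j < 5)%N -> last (p i) (g i j) = p j) ->
  ~ (forall i j k l, (i < j < 5)%N -> (k < l < 5)%N -> uniq [:: i; j; k; l] ->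
     disjoint_polygons (p i) (g i j) (p k) (g k l)).
Proof.
move=> pinj lastg dis.
pose V i j := p i :: g i j.
have [eps inj] := separating_abscissa (flatten [seq V i j | i <- iota 0 5, j <- iota 0 5]).
have memV i j a : (i < 5)%N -> (j < 5)%N -> a \in V i j ->
    a \in flatten [seq V i j | i <- iota 0 5, j <- iota 0 5].
  move=> i5 j5 aV; apply/flattenP; exists (V i j) => //.
  by apply: allpairs_f; rewrite mem_iota.
(* Equal abscissae would mean a common vertex of the two arcs, against their disjointness. *)
have ne i j k l a c : (i < j < 5)%N -> (k < l < 5)%N -> uniq [:: i; j; k; l] ->
    a \in V i j -> c \in V k l -> absc eps a != absc eps c.
  move=> ij kl u aV cV; apply/eqP => /inj.
  move=> /(_ (memV i j a ltac:(lia) ltac:(lia) aV) (memV k l c ltac:(lia) ltac:(lia) cV)) ac.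
  apply: (dis i j k l ij kl u a); first exact: polygon_mem.
  by rewrite ac; exact: polygon_mem.
apply: (@K5_parity_absurd (fun i j k => above_path eps (p i) (g i j) (p k))
  (fun i j => absc eps (p i) < absc eps (p j))).
  move=> i j /andP[ij j5]; have i5 := ltn_trans ij j5.
  rewrite -leNgt lt_neqAle andb_idl // => _; apply/eqP => /inj.
  move=> /(_ (memV j j _ j5 j5 (mem_head _ _)) (memV i i _ i5 i5 (mem_head _ _))) /pinj.
  by move=> /(_ j5 i5) ji; rewrite ji ltnn in ij.
move=> i j k l j5 l5 ij kl u.
have ij5 : (i < j < 5)%N by rewrite ij.
have kl5 : (k < l < 5)%N by rewrite kl.
have := path_parity (dis i j k l ij5 kl5 u) (fun a c => ne i j k l a c ij5 kl5 u).
by rewrite !lastg.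
Qed.

(** * Contraction and the edge bound *)

Local Open Scope nat_scope.

(* Polygonal arcs of which only those of vertex-disjoint edges have to be disjoint: unlike
   plane drawings, such drawings survive edge contraction by mere concatenation. *)
Definition drawable (R : realFieldType) (T : finType) (A : {set T}) (e : rel T) : Prop :=
  exists (p : T -> R * R) (g : T -> T -> seq (R * R)),
  [/\ {in A &, injective p},
      {in A &, forall x y, e x y -> last (p x) (g x y) = p y} &
      forall x y u v, {subset [:: x; y; u; v] <= A} -> uniq [:: x; y; u; v] ->
        e x y -> e u v -> disjoint_polygons (p x) (g x y) (p u) (g u v)].

Lemma drawable_sub (R : realFieldType) (T : finType) (A B : {set T}) (e f : rel T) :
  B \subset A -> subrel f e -> drawable R A e -> drawable R B f.
Proof.
move=> /subsetP BA fe [p [g [pinj glast gdis]]]; exists p, g; split.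
- by move=> x y /BA Ax /BA Ay; exact: pinj.
- by move=> x y /BA Ax /BA Ay /fe; exact: glast.
- by move=> x y u v BS U /fe exy /fe euv; apply: gdis => // z /BS /BA.
Qed.

(** [b] keeps its edges here and disappears only by passing to [A :\ b]; the guards [y != a] and
    [x != a] prevent a loop at [a]. *)
Definition contract (T : finType) (a b : T) (e : rel T) : rel T := fun x y =>
  [|| e x y, [&& x == a, y != a & e b y] | [&& y == a, x != a & e x b]].

(** An edge that [a] takes over from [b] is drawn through [b] along two old arcs. Of two
    vertex-disjoint edges at most one ends in [a], so at most one uses arcs at [b], and disjointness
    is inherited. *)
Lemma drawable_contract (R : realFieldType) (T : finType) (A : {set T}) (e : rel T) (a b : T) :
  symmetric e -> irreflexive e -> a \in A -> b \in A -> e a b ->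
  drawable R A e -> drawable R (A :\ b) (contract a b e).
Proof.
move=> esym eirr Aa Ab eab [p [g [pinj glast gdis]]].
have eba : e b a by rewrite esym.
pose g' x y := if e x y then g x y
  else if x == a then g a b ++ g b y else g x b ++ g b a.
(* A point of a new arc lies on an old arc with ends among [x], [y] and, only if [a] is one of
   these, [b]. *)
have g'P x y q : x \in A :\ b -> y \in A :\ b -> contract a b e x y ->
    polygon (p x) (g' x y) q ->
    exists s t, [/\ e s t, polygon (p s) (g s t) q,
      (s \in A) && (t \in A) &
      {subset [:: s; t] <= [predU [:: x; y] & [pred z | (z == b) && (a \in [:: x; y])]]}].
  rewrite /g' !inE => /andP[xb Ax] /andP[yb Ay].
  have [exy _ xyq|nexy] := boolP (e x y).
    exists x, y; split; rewrite ?Ax ?Ay //.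
    by move=> z zxy; rewrite inE /= zxy.
  rewrite /contract (negbTE nexy) /= => /orP[]/and3P[].
    move=> /eqP xa ya eby; rewrite xa eqxx => /polygon_cat[abq|].
      exists a, b; split; rewrite ?Aa ?Ab //.
      by move=> z; rewrite !inE => /orP[]/eqP->; rewrite !eqxx /= ?orbT.
    rewrite (glast a b) // => byq; exists b, y; split; rewrite ?Ab ?Ay //.
    by move=> z; rewrite !inE => /orP[]/eqP->; rewrite !eqxx /= ?orbT.
  move=> /eqP ya xa exb; rewrite (negbTE xa) => /polygon_cat[xbq|].
    exists x, b; split; rewrite ?Ax ?Ab //.
    by move=> z; rewrite !inE ya => /orP[]/eqP->; rewrite !eqxx /= ?orbT.
  rewrite (glast x b) // => baq; exists b, a; split; rewrite ?Ab ?Aa //.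
  by move=> z; rewrite !inE ya => /orP[]/eqP->; rewrite !eqxx /= ?orbT.
exists p, g'; split.
- by move=> x y /setD1P[_ Ax] /setD1P[_ Ay]; exact: pinj.
- move=> x y /setD1P[xb Ax] /setD1P[yb Ay].
  rewrite /contract /g'; case: ifP => [exy _|_]; first exact: glast.
  rewrite /=; case/orP=> [/and3P[/eqP-> _ eby]|/and3P[/eqP-> /negbTE-> exb]];
    by rewrite ?eqxx last_cat !glast.
move=> x y u v sA U cxy cuv q.
have [Ax Ay Au Av] : [/\ x \in A :\ b, y \in A :\ b, u \in A :\ b & v \in A :\ b].
  by split; apply: sA; rewrite !inE eqxx ?orbT.
move=> /(g'P _ _ _ Ax Ay cxy)[s [t [est stq /andP[As At] sst]]].
move=> /(g'P _ _ _ Au Av cuv)[s' [t' [est' stq' /andP[As' At'] sst']]].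
have dis z : z \in [:: s; t] -> z \in [:: s'; t'] -> False.
  move=> /sst + /sst'; move: U Ax Ay Au Av; rewrite /= !inE !negb_or.
  move=> /and4P[/and3P[xy xu xv] /andP[yu yv] uv _] /andP[xb _] /andP[yb _] /andP[ub _] /andP[vb _].
  case/orP=> [/orP[]/eqP->|/andP[/eqP-> axy]];
  rewrite ?(negbTE xu) ?(negbTE xv) ?(negbTE yu) ?(negbTE yv) ?(negbTE xb) ?(negbTE yb) //=.
  rewrite ![b == _]eq_sym (negbTE ub) (negbTE vb) eqxx /=.
  move: axy => /orP[]/eqP ->; by rewrite ?(negbTE xu) ?(negbTE xv) ?(negbTE yu) ?(negbTE yv).
have nst : s != t by apply: contraTN est => /eqP->; rewrite eirr.
have nst' : s' != t' by apply: contraTN est' => /eqP->; rewrite eirr.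
apply: (gdis s t s' t' _ _ est est' q) => //.
  by move=> z; rewrite !inE => /or4P[]/eqP->.
have := dis s; have := dis t; rewrite /= !inE !eqxx !orbT /= => dt ds.
rewrite negb_or nst nst' !andbT /=.
by apply/andP; split; apply/negP; [exact: ds|exact: dt].
Qed.

Lemma drawable_K5_free (R : realFieldType) (T : finType) (A S : {set T}) (e : rel T) :
  S \subset A -> {in S &, forall x y, x != y -> e x y} -> drawable R A e -> #|S| != 5.
Proof.
move=> SA clq dr; apply/eqP => S5.
have {dr} [p [g [pinj glast gdis]]] : drawable R S e by apply: drawable_sub dr.
have [x0 Sx0] : exists x0, x0 \in S by apply/set0Pn; rewrite -cards_eq0 S5.
pose v i := nth x0 (enum S) i.
have vS i : i < 5 -> v i \in S by move=> i5; rewrite -mem_enum mem_nth // -cardE S5.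
have vinj i j : i < 5 -> j < 5 -> (v i == v j) = (i == j).
  by move=> i5 j5; rewrite nth_uniq ?enum_uniq // -cardE S5.
have ve i j : i < j < 5 -> e (v i) (v j).
  move=> /andP[ij j5]; have i5 := ltn_trans ij j5.
  by apply: clq; rewrite ?vS // vinj // neq_ltn ij.
apply: (@K5_polygons_meet R (p \o v) (fun i j => g (v i) (v j))).
- move=> i j i5 j5 /= /pinj; move=> /(_ (vS i i5) (vS j j5)) /eqP.
  by rewrite vinj // => /eqP.
- move=> i j ij; have /andP[ij' j5] := ij; have i5 := ltn_trans ij' j5.
  by apply: glast; rewrite ?vS ?ve.
move=> i j k l ij kl U.
have [i5 j5 k5 l5] : [/\ i < 5, j < 5, k < 5 & l < 5] by split; lia.
apply: (gdis (v i) (v j) (v k) (v l) _ _ (ve i j ij) (ve k l kl)).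
  by move=> z; rewrite !inE => /or4P[]/eqP->; exact: vS.
by move: U; rewrite /= !inE !vinj.
Qed.

(** * Degree sums under deletion and contraction *)

Definition nbr (T : finType) (A : {set T}) (e : rel T) (x : T) : {set T} :=
  [set y in A | e x y].

(** For a symmetric irreflexive relation this is twice the number of edges within [A]. *)
Definition darts (T : finType) (A : {set T}) (e : rel T) : nat :=
  \sum_(x in A) #|nbr A e x|.

Section Count.
Variables (T : finType) (A : {set T}) (e : rel T).
Hypotheses (esym : symmetric e) (eirr : irreflexive e).

Lemma nbr_sub x : nbr A e x \subset A :\ x.
Proof.
by apply/subsetP => y; rewrite !inE => /andP[-> exy]; rewrite andbT;
  apply: contraTneq exy => ->; rewrite eirr.
Qed.

Lemma card_nbr_lt x : x \in A -> #|nbr A e x| < #|A|.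
Proof.
by move=> Ax; rewrite (cardsD1 x A) Ax add1n ltnS subset_leq_card ?nbr_sub.
Qed.

(** [v] takes away its own degree and one dart from each neighbour. *)
Lemma darts_delete v : v \in A -> darts A e = darts (A :\ v) e + 2 * #|nbr A e v|.
Proof.
move=> Av; rewrite {1}/darts (big_setD1 v) //=.
suff -> : \sum_(x in A :\ v) #|nbr A e x| = darts (A :\ v) e + #|nbr A e v| by lia.
have -> : #|nbr A e v| = \sum_(x in A :\ v) (v \in nbr A e x).
  rewrite -sum1_card big_mkcond /= [RHS]big_mkcond /=; apply: eq_bigr => x _.
  rewrite !inE Av /= esym; case: (eqVneq x v) => [->|] /=; rewrite ?eirr ?andbF //.
  by case: (x \in A); case: (e x v).
rewrite /darts -big_split /=; apply: eq_bigr => x; rewrite !inE => /andP[xv Ax].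
rewrite (cardsD1 v) addnC; congr (_ + _); last by rewrite !inE.
by apply: eq_card => y; rewrite !inE andbA.
Qed.

Definition delete_edge (a b : T) : rel T := fun x y =>
  e x y && ~~ (((x == a) && (y == b)) || ((x == b) && (y == a))).

Lemma darts_delete_edge a b : a \in A -> b \in A -> e a b ->
  darts A e = darts A (delete_edge a b) + 2.
Proof.
move=> Aa Ab eab; have ab : a != b by apply: contraTneq eab => ->; rewrite eirr.
have -> : 2 = \sum_(x in A) ((x == a) + (x == b)).
  rewrite big_split /= (big_setD1 a) //= eqxx big1 => [|x]; last by rewrite !inE => /andP[/negbTE->].
  by rewrite (big_setD1 b) //= eqxx big1 // => x; rewrite !inE => /andP[/negbTE->].
rewrite /darts -big_split /=; apply: eq_bigr => x Ax.
case: (eqVneq x a) => [->|xa]; rewrite /=.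
  rewrite (negbTE ab) (cardsD1 b) !inE Ab eab addnC addn0; congr (_ + _).
  apply: eq_card => y; rewrite !inE /delete_edge eqxx (negbTE ab) /= orbF.
  by case: (y == b) (y \in A) (e a y) => [] [] [].
case: (eqVneq x b) => [->|xb]; rewrite /=.
  rewrite (cardsD1 a) !inE Aa (esym b a) eab addnC; congr (_ + _).
  apply: eq_card => y; rewrite !inE /delete_edge eqxx (eq_sym b) (negbTE ab) /=.
  by case: (y == a) (y \in A) (e b y) => [] [] [].
rewrite !addn0; apply: eq_card => y.
by rewrite !inE /delete_edge (negbTE xa) (negbTE xb) andbT.
Qed.

(** Contraction loses the edge [a b] and, at each common neighbour, one of its two edges to [a] and
    [b], which merge. *)
Lemma darts_contract a b : a \in A -> b \in A -> e a b ->
  darts A e <= darts (A :\ b) (contract a b e)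
               + 2 * (#|nbr A e a :&: nbr A e b| + 1).
Proof.
move=> Aa Ab eab; have ab : a != b by apply: contraTneq eab => ->; rewrite eirr.
have ba : b != a by rewrite eq_sym.
have Aba : a \in A :\ b by rewrite !inE ab.
rewrite /darts (big_setD1 b) //= (big_setD1 a) //= [X in _ <= X + _](big_setD1 a) //=.
set N := nbr A e a :&: nbr A e b.
have main x : x \in A :\ b :\ a ->
    #|nbr A e x| <= #|nbr (A :\ b) (contract a b e) x| + (x \in N).
  rewrite !inE => /and3P[xa xb Ax]; rewrite Ax /= (esym a) (esym b).
  have [xb_edge|nxb] := boolP (e x b); last first.
    rewrite andbF addn0; apply: subset_leq_card; apply/subsetP => y.
    rewrite !inE /contract => /andP[-> exy]; rewrite exy !andbT /=.
    by apply: contraTneq exy => ->.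
  rewrite andbT (cardsD1 b) !inE Ab xb_edge /= add1n.
  have [xa_edge|nxa] := boolP (e x a).
    rewrite addn1 ltnS; apply: subset_leq_card; apply/subsetP => y.
    by rewrite !inE /contract => /and3P[-> -> ->].
  rewrite addn0 (cardsD1 a (nbr (A :\ b) _ x)) !inE ab Aa /contract eqxx xb_edge xa !orbT add1n ltnS.
  apply: subset_leq_card; apply/subsetP => y; rewrite !inE => /and3P[yb Ay exy].
  by rewrite yb Ay exy !andbT /=; apply: contraTneq exy => ->.
(* Inclusion-exclusion for the two neighbourhoods; the 2 stands for [a] and [b], which lie in the
   union but are not neighbours of the merged vertex. *)
have suma : #|nbr A e b| + #|nbr A e a| <=
    #|nbr (A :\ b) (contract a b e) a| + #|N| + 2.
  rewrite addnC -cardsUI -/N.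
  have -> : #|nbr A e a :|: nbr A e b| = #|(nbr A e a :|: nbr A e b) :\ a :\ b| + 2.
    by rewrite (cardsD1 a) (cardsD1 b (_ :\ a)) !inE Aa Ab eab (esym b) eab ba /= orbT; lia.
  rewrite [X in _ <= X]addnAC leq_add2r leq_add2r; apply: subset_leq_card; apply/subsetP => y.
  rewrite !inE /contract eqxx => /and3P[yb ya /orP[]/andP[-> ey]];
    by rewrite yb ya ey ?orbT.
have NS : #|N| = \sum_(x in A :\ b :\ a) (x \in N).
  rewrite -sum1_card big_mkcond /= [RHS]big_mkcond /=; apply: eq_bigr => x _.
  rewrite !inE; case: (eqVneq x a) => [->|] /=; first by rewrite eirr andbF.
  case: (eqVneq x b) => [->|] /=; first by rewrite eirr !andbF.
  by case: (x \in A) => //=; case: ifP.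
have := @leq_sum _ (index_enum T) _ _ _ main; rewrite big_split /= -NS => H; lia.
Qed.
End Count.

Lemma darts_le (T : finType) (A : {set T}) (e : rel T) (d : nat) :
  {in A, forall x, #|nbr A e x| <= d} -> darts A e <= #|A| * d.
Proof. by move=> led; rewrite -sum_nat_const; exact: leq_sum. Qed.

Lemma darts_ge (T : finType) (A : {set T}) (e : rel T) (d : nat) :
  {in A, forall x, d <= #|nbr A e x|} -> #|A| * d <= darts A e.
Proof. by move=> led; rewrite -sum_nat_const; exact: leq_sum. Qed.

Lemma contract_sym (T : finType) (a b : T) (e : rel T) :
  symmetric e -> symmetric (contract a b e).
Proof.
move=> esym x y; rewrite /contract (esym y x) (esym x b) (esym y b).
by rewrite [X in _ || X]orbC.
Qed.

Lemma contract_irr (T : finType) (a b : T) (e : rel T) :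
  irreflexive e -> irreflexive (contract a b e).
Proof. by move=> eirr x; rewrite /contract eirr; case: (x == a). Qed.

(* In a minimal counterexample every edge lies in three triangles, or it could be contracted.
   Hence a vertex of degree 4 would span a K5 with its neighbours, and a vertex of degree 5
   would span with its neighbours a counterexample on 6 vertices. *)
Lemma drawable_darts (R : realFieldType) (T : finType) (A : {set T}) (e : rel T) :
  symmetric e -> irreflexive e -> drawable R A e -> 3 <= #|A| ->
  darts A e + 12 <= 6 * #|A|.
Proof.
(* The outer induction is on vertices, the inner one on darts; the latter makes a counterexample
   exceed the bound by a single edge at most. *)
have [n] := ubnP #|A|; elim: n => // n IHn in A e *.
have [k] := ubnP (darts A e); elim: k => // k IHk in A e *.
move=> ltk ltn esym eirr dr A3.
rewrite leqNgt; apply/negP => big.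
have degA x : x \in A -> #|nbr A e x| < #|A| by exact: card_nbr_lt.
(* On 3 or 4 vertices even the complete graph satisfies the bound, with equality. *)
have A5 : 5 <= #|A|.
  have : darts A e <= #|A| * #|A|.-1.
    by apply: darts_le => x /degA; case: #|A|.
  by move: A3 big; case: #|A| => [|[|[|[|[|?]]]]] //=; lia.
have subIH (B : {set T}) : B \proper A -> 3 <= #|B| -> darts B e + 12 <= 6 * #|B|.
  move=> BA; apply: IHn => //; last exact: drawable_sub (proper_sub BA) _ dr.
  by have := proper_card BA; lia.
(* One vertex fewer lowers the bound by 6, so more than 6 darts must go with it: this gives degree
   at least 4 here, and three common neighbours in [common3]. *)
have deg4 v : v \in A -> 4 <= #|nbr A e v|.
  move=> Av; have := subIH (A :\ v) (properD1 Av); have := cardsD1 v A; rewrite Av.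
  by have := darts_delete esym eirr Av; lia.
have common3 a b : a \in A -> b \in A -> e a b -> 3 <= #|nbr A e a :&: nbr A e b|.
  move=> Aa Ab eab; have := darts_contract esym eirr Aa Ab eab.
  have := cardsD1 b A; rewrite Ab => AD.
  have := IHn (A :\ b) (contract a b e).
  have -> : #|A :\ b| < n by lia.
  move=> /(_ isT (contract_sym _ _ esym) (contract_irr _ _ eirr)).
  by move=> /(_ (drawable_contract esym eirr Aa Ab eab dr)); lia.
have deg5 v : v \in A -> 5 <= #|nbr A e v|.
  move=> Av; have := deg4 v Av; rewrite leq_eqVlt => /predU1P[|//] d4.
  have vN : v \notin nbr A e v by rewrite !inE eirr andbF.
  have : #|v |: nbr A e v| != 5.
    apply: drawable_K5_free dr; first by rewrite subUset sub1set Av; apply/subsetP => y; rewrite inE => /andP[].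
    have Nclq x y : x \in nbr A e v -> y \in nbr A e v -> x != y -> e x y.
      move=> Nx Ny xy; have := Nx; rewrite inE => /andP[Ax evx].
      have sub : nbr A e v :&: nbr A e x \subset nbr A e v :\ x.
        by rewrite subsetD1 subsetIl !inE eirr !andbF.
      have eqN : nbr A e v :&: nbr A e x = nbr A e v :\ x.
        apply/eqP; rewrite eqEcard sub /=; have := cardsD1 x (nbr A e v); rewrite Nx.
        by have := common3 v x Av Ax evx; lia.
      have : y \in nbr A e v :\ x by rewrite in_setD1 eq_sym xy.
      by rewrite -eqN !inE => /andP[_ /andP[]].
    move=> x y; rewrite !in_setU1 => /predU1P[->|Nx] /predU1P[->|Ny]; first by rewrite eqxx.
    - by move: Ny; rewrite inE => /andP[].
    - by move: Nx; rewrite inE esym => /andP[].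
    - exact: Nclq.
  by rewrite cardsU1 vN -d4.
have [w Aw] : exists w, w \in A by apply/set0Pn; rewrite -card_gt0; lia.
have [u Nu] : exists u, u \in nbr A e w.
  by apply/set0Pn; rewrite -card_gt0; have := deg4 w Aw; lia.
(* Without the edge [w u] the bound holds, so the average degree is below 6 and some vertex has
   degree at most 5. *)
have darts_up : darts A e <= 6 * #|A| - 10.
  move: Nu; rewrite inE => /andP[Au ewu].
  have := darts_delete_edge esym eirr Aw Au ewu.
  have := IHk A (delete_edge e w u).
  have -> : darts A (delete_edge e w u) < k by have := darts_delete_edge esym eirr Aw Au ewu; lia.
  move=> /(_ isT ltn) H; suff : darts A (delete_edge e w u) + 12 <= 6 * #|A| by lia.
  apply: H => //.
  - move=> x y; rewrite /delete_edge esym orbC.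
    by rewrite [(x == u) && _]andbC [(x == w) && _]andbC.
  - by move=> x; rewrite /delete_edge eirr.
  - by apply: drawable_sub dr => // x y /andP[].
have [v Av degv] : exists2 v, v \in A & #|nbr A e v| <= 5.
  apply/exists_inP; apply: contraT => /exists_inPn all6.
  have : #|A| * 6 <= darts A e by apply: darts_ge => x /all6; rewrite ltnNge.
  by lia.
have {degv} degv : #|nbr A e v| = 5 by apply/eqP; rewrite eqn_leq degv deg5.
pose S := v |: nbr A e v.
have vN : v \notin nbr A e v by rewrite !inE eirr andbF.
have SA : S \subset A by rewrite subUset sub1set Av; apply/subsetP => y; rewrite inE => /andP[].
have cardS : #|S| = 6 by rewrite cardsU1 vN degv.
have [SpA|] := boolP (S \proper A); last first.
  (* If [S] is all of [A], degrees at least 5 give 30 darts, against at most 26 by [darts_up]. *)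
  rewrite properE SA negbK => AS.
  have A6 : #|A| = 6 by rewrite -cardS; apply/eqP; rewrite eqn_leq !subset_leq_card.
  by have := darts_ge deg5; lia.
(* [v] has 5 darts in [S], and each of its five neighbours at least 4: to [v] and to three common
   neighbours. These are 25, but six vertices allow only 24. *)
have := subIH S SpA; rewrite cardS => /(_ isT).
have : 5 <= #|nbr S e v|.
  rewrite -degv; apply: subset_leq_card; apply/subsetP => y Ny.
  by rewrite inE in_setU1 Ny orbT; move: Ny; rewrite inE => /andP[].
have : 5 * 4 <= \sum_(x in nbr A e v) #|nbr S e x|.
  rewrite -degv -sum_nat_const; apply: leq_sum => x Nx.
  have := Nx; rewrite inE => /andP[Ax evx].
  have := common3 v x Av Ax evx; rewrite -ltnS => /leq_trans; apply.
  rewrite (cardsD1 v (nbr S e x)) !inE eqxx (esym x) evx /= add1n ltnS.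
  apply: subset_leq_card; apply/subsetP => y; rewrite !inE => /andP[/andP[Ay evy] /andP[_ exy]].
  by rewrite Ay evy exy orbT !andbT; apply: contraTneq evy => ->; rewrite eirr.
by rewrite /darts /S big_setU1 //=; lia.
Qed.

(** * Chromatic number and independence number *)

Section Graph.
Variables (T : finType) (e : rel T).
Hypotheses (e_sym : symmetric e) (e_irr : irreflexive e).

Lemma dartsE : darts [set: T] e = #|[set w : T * T | e w.1 w.2]|.
Proof.
rewrite /darts -sum1dep_card -(pair_big_dep xpredT (fun x y => e x y) (fun _ _ => 1)) /=.
rewrite (eq_bigl xpredT) => [|x]; last by rewrite inE.
by apply: eq_bigr => x _; rewrite sum1dep_card; apply: eq_card => y; rewrite !inE.
Qed.

(** The map from ordered adjacent pairs to edges is two-to-one. *)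
Lemma darts_nedges : darts [set: T] e = 2 * nedges e.
Proof.
pose pr (w : T * T) := [set w.1; w.2]%SET.
pose D := [set w : T * T | e w.1 w.2]%SET.
rewrite dartsE -/D.
have -> : nedges e = #|pr @: D|.
  apply: eq_card => E; rewrite !inE; apply/existsP/imsetP => [[x /existsP[y /andP[exy /eqP->]]]|].
    by exists (x, y); rewrite ?inE.
  by case=> [[x y]]; rewrite inE /= => exy ->; exists x; apply/existsP; exists y; rewrite exy eqxx.
rewrite -sum1_card (partition_big_imset pr) /= mulnC -sum_nat_const; apply: eq_bigr => E.
case/imsetP=> [[x y]]; rewrite inE /= => exy ->.
have xy : x != y by apply: contraTneq exy => ->; rewrite e_irr.
have -> : 2 = #|[set (x, y); (y, x)]%SET|.
  by rewrite cards2 xpair_eqE (negbTE xy).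
rewrite sum1dep_card; apply: eq_card => [[u v]]; rewrite !inE /= !xpair_eqE.
apply/andP/orP => [[euv /eqP/setP prE]|].
  have uv : u != v by apply: contraTneq euv => ->; rewrite e_irr.
  have uE : (u == x) || (u == y) by rewrite -in_set2 -prE in_set2 eqxx.
  have vE : (v == x) || (v == y) by rewrite -in_set2 -prE in_set2 eqxx orbT.
  move: uE vE uv => /orP[]/eqP-> /orP[]/eqP-> uv; rewrite ?eqxx /= in uv *; by [|left|right].
by case=> /andP[/eqP-> /eqP->]; split=> //; [rewrite e_sym|rewrite /pr /= setUC].
Qed.

Lemma card_colorable : colorableb e #|T|.
Proof.
apply/existsP; exists [ffun x => enum_rank x]; apply/forallP => x; apply/forallP => y.
apply/implyP => exy; rewrite !ffunE (inj_eq enum_rank_inj).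
by apply: contraTneq exy => ->; rewrite e_irr.
Qed.

Lemma chromatic_colorable : colorableb e (chromatic_number e).
Proof.
(* The default [#|T|] of the minimum is itself a sufficient number of colours. *)
rewrite /chromatic_number; elim/big_ind: _ => //; first exact: card_colorable.
by move=> i j ci cj; rewrite /minn; case: ifP.
Qed.

Lemma chromatic_le k : k <= #|T| -> colorableb e k -> chromatic_number e <= k.
Proof.
move=> kT ck; rewrite /chromatic_number.
have : Ordinal (kT : k < #|T|.+1) \in index_enum 'I_#|T|.+1 by rewrite mem_index_enum.
elim: (index_enum _) => // i r IHr; rewrite inE big_cons => /predU1P[<-|/IHr le_k].
  by rewrite /= ck geq_minl.
by case: ifP => // _; rewrite geq_min le_k orbT.
Qed.

(** With vertices as colours, a colouring can be given by merging vertices, without numbering the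
    classes. *)
Lemma chromatic_le_image (f : T -> T) :
  (forall x y, e x y -> f x != f y) -> chromatic_number e <= #|f @: [set: T]|.
Proof.
move=> fP; apply: chromatic_le.
  by rewrite -cardsT leq_imset_card.
have fI x : f x \in f @: [set: T] by apply: imset_f; rewrite inE.
apply/existsP; exists [ffun x => enum_rank_in (fI x) (f x)].
apply/forallP => x; apply/forallP => y; apply/implyP => exy; rewrite !ffunE.
apply: contraNneq (fP x y exy) => /(congr1 enum_val).
by rewrite !enum_rankK_in // => ->.
Qed.

Lemma chromatic_coloring :
  exists f : T -> 'I_(chromatic_number e), forall x y, e x y -> f x != f y.
Proof.
have /existsP[f /forallP fP] := chromatic_colorable.
by exists f => x y; have /forallP/(_ y)/implyP := fP x.
Qed.

Lemma chromatic_ge2 x y : e x y -> 2 <= chromatic_number e.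
Proof.
have [f fP] := chromatic_coloring; move=> /fP; rewrite -(inj_eq val_inj) /=.
by have := ltn_ord (f x); have := ltn_ord (f y); lia.
Qed.

Lemma independence_ge1 (x : T) : 1 <= independence_number e.
Proof.
have := @leq_bigmax_cond _ (independentb e) (fun S : {set T} => #|S|) [set x]%SET.
rewrite cards1; apply; apply/forall_inP => y; rewrite inE => /eqP->.
by apply/forall_inP => z; rewrite inE => /eqP->; rewrite e_irr.
Qed.

Lemma independence_attained :
  exists2 S : {set T}, independentb e S & independence_number e = #|S|.
Proof.
have ind0 : independentb e set0 by apply/forall_inP => y; rewrite inE.
have [|S indS SE] := @eq_bigmax_cond _ (independentb e) (fun S : {set T} => #|S|).
  by apply/card_gt0P; exists set0.
by exists S.
Qed.

Lemma independentP (S : {set T}) x y : independentb e S -> x \in S -> y \in S -> ~~ e x y.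
Proof. by move=> /forall_inP/(_ x)H /H/forall_inP/(_ y). Qed.

(** All of [S] gets the colour [s], and every other vertex a colour of its own. *)
Lemma chromatic_independent (S : {set T}) s : independentb e S -> s \in S ->
  chromatic_number e + #|S| <= #|T| + 1.
Proof.
move=> indS Ss; pose f x := if x \in S then s else x.
have fP x y : e x y -> f x != f y.
  rewrite /f => exy; case: ifPn => Sx; case: ifPn => Sy.
  - by have := independentP indS Sx Sy; rewrite exy.
  - by apply: contraNneq Sy => <-.
  - by apply: contraNneq Sx => ->.
  - by apply: contraTneq exy => ->; rewrite e_irr.
have : #|f @: [set: T]| <= #|s |: ~: S|.
  apply: subset_leq_card; apply/subsetP => _ /imsetP[x _ ->].
  by rewrite /f !inE; case: ifPn => [|->]; rewrite ?eqxx ?orbT.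
move=> /(leq_trans (chromatic_le_image fP)).
by rewrite cardsU1 !inE Ss /= -(cardsC S); lia.
Qed.

(* Two non-adjacent vertices outside an independent set can share a colour. *)
Lemma chromatic_independent_lt (S : {set T}) s u v : independentb e S -> s \in S ->
  u \notin S -> v \notin S -> u != v -> ~~ e u v -> chromatic_number e + #|S| <= #|T|.
Proof.
move=> indS Ss Su Sv uv neuv; pose f x := if x \in S then s else if x == v then u else x.
have fP x y : e x y -> f x != f y.
  rewrite /f => exy; case: (boolP (x \in S)) => Sx; case: (boolP (y \in S)) => Sy.
  - by have := independentP indS Sx Sy; rewrite exy.
  - by case: ifP => _; apply/eqP => E; [rewrite -E Ss in Su|rewrite -E Ss in Sy].
  - by case: ifP => _; apply/eqP => E; [rewrite E Ss in Su|rewrite E Ss in Sx].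
  - case: (eqVneq x v) => [xv|xv]; case: (eqVneq y v) => [yv|yv].
    + by rewrite xv yv e_irr in exy.
    + by apply: contraTneq exy => <-; rewrite xv e_sym.
    + by apply: contraTneq exy => ->; rewrite yv.
    + by apply: contraTneq exy => ->; rewrite e_irr.
have : #|f @: [set: T]| <= #|s |: ((~: S) :\ v)|.
  apply: subset_leq_card; apply/subsetP => _ /imsetP[x _ ->].
  rewrite /f !inE; case: ifPn => [|Sx]; first by rewrite eqxx.
  by case: (eqVneq x v) => [xv|xv]; rewrite ?uv ?Su ?xv ?Sx orbT.
move=> /(leq_trans (chromatic_le_image fP)).
rewrite cardsU1 !inE Ss andbF /=; have := cardsD1 v (~: S); rewrite inE Sv.
by rewrite -(cardsC S); lia.
Qed.

(** A vertex has no neighbour in its own class. Summing over vertices bounds the darts by [#|T| ^ 2]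
    minus the sum of squared class sizes, which is at least a third of [#|T| ^ 2]. *)
Lemma darts_3colorable (f : T -> 'I_3) :
  (forall x y, e x y -> f x != f y) -> 3 * darts [set: T] e <= 2 * #|T| ^ 2.
Proof.
move=> fP; pose N c := #|[set y | f y == c]%SET|.
have degN x : #|nbr [set: T] e x| + N (f x) <= #|T|.
  rewrite -(cardsC [set y | f y == f x]%SET) [X in _ <= X]addnC leq_add2r.
  apply: subset_leq_card; apply/subsetP => y; rewrite !inE /= => /fP.
  by rewrite eq_sym.
have sumN : darts [set: T] e + \sum_(x : T) N (f x) <= #|T| * #|T|.
  rewrite /darts (eq_bigl xpredT) => [|x]; last by rewrite inE.
  rewrite -big_split /= -sum_nat_const; exact: leq_sum.
have sqN : \sum_(x : T) N (f x) = \sum_(c < 3) N c * N c.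
  rewrite (partition_big f xpredT) //=; apply: eq_bigr => c _.
  rewrite (eq_bigr (fun=> N c)) => [|x /eqP->//].
  by rewrite sum_nat_const; congr (_ * _); apply: eq_card => y; rewrite !inE.
have cardN : #|T| = \sum_(c < 3) N c.
  rewrite -sum1_card (partition_big f xpredT) //=; apply: eq_bigr => c _.
  by rewrite sum1dep_card.
move: sumN; rewrite sqN cardN !big_ord_recr !big_ord0 /= !add0n.
move: (N _) (N _) (N _) (darts _ _) => a b c d.
have [ab _] := nat_Cauchy a b; have [bc _] := nat_Cauchy b c; have [ac _] := nat_Cauchy a c.
by rewrite -!mulnn in ab bc ac *; lia.
Qed.
End Graph.

(** * Arithmetic of the planar case *)

(** The difference of the two sides is $(2d-c)^2(4c+d)$. *)
Lemma cubic_AGM (c d : nat) : 27 * (c * c * d) <= 4 * (c + d) ^ 3.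
Proof.
have := Num.Theory.mulr_ge0 (Num.Theory.sqr_ge0 (2 * d%:Z - c%:Z)%R)
  (isT : 0 <= (4 * c + d)%:Z)%R.
by lia.
Qed.

(** A finite check. The excluded pair really fails: for [n = 8] and [c = 6] the left side is
    2099520, while $8^7 = 2097152$. *)
Lemma planar_count_small (n c b : nat) :
  3 <= n < 16 -> 2 <= c <= n + 1 -> b * 2 = c * (c - 1) -> ~~ ((n == 8) && (c == 6)) ->
  4 * (3 * n - 6) ^ 3 * b * minn n (2 * (n + 1 - c)) <= n ^ 7.
Proof.
move=> n16 cn b2.
have : c \in iota 2 15 by rewrite mem_iota; lia.
have : n \in iota 3 13 by rewrite mem_iota; lia.
rewrite /= !inE => /(elimT predU1P) nE /(elimT predU1P) cE.
by repeat (case: nE => [nE|/orP nE]); repeat (case: cE => [cE|/orP cE]);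
   rewrite ?(eqP nE) ?(eqP cE); lia.
Qed.

(** Here [c] and [a] stand for the chromatic and independence numbers and [t] for twice theta. From
    16 vertices on, [cubic_AGM] reduces the left side to at most $16((n-2)(n+1))^3 \le 16n^6$;
    smaller [n] are checked one by one. *)
Lemma planar_count_le (n m c a t : nat) :
  3 <= n -> m + 6 <= 3 * n -> 2 <= c -> a + c <= n + 1 -> (n = 8 -> c = 6 -> a <= 2) ->
  t <= n -> t <= 2 * a -> 4 * m ^ 3 * 'C(c, 2) * t <= n ^ 7.
Proof.
move=> n3 mn c2 acn n8 tn ta.
have mM : m ^ 3 <= (3 * n - 6) ^ 3 by rewrite leq_exp2r //; lia.
have b2 : 'C(c, 2) * 2 = c * (c - 1).
  by have := mul_bin_diag c 1; rewrite bin1 subn1 => E; rewrite mulnC -E.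
have [n16|n16] := leqP 16 n.
  have amgm : 27 * (c * (c - 1) * (n + 1 - c)) <= 4 * (n + 1) ^ 3.
    have : 27 * (c * c * (n + 1 - c)) <= 4 * (n + 1) ^ 3.
      by have := cubic_AGM c (n + 1 - c); rewrite subnKC //; lia.
    by apply: leq_trans; rewrite leq_mul2l /= leq_mul2r leq_mul2l; lia.
  have step : 4 * m ^ 3 * 'C(c, 2) * t <= 4 * (3 * n - 6) ^ 3 * (c * (c - 1) * (n + 1 - c)).
    have : 4 * m ^ 3 * 'C(c, 2) * t <= 4 * (3 * n - 6) ^ 3 * 'C(c, 2) * (2 * (n + 1 - c)).
      by do 2 ?apply: leq_mul => //; lia.
    by rewrite -b2 -!mulnA.
  apply: leq_trans step _.
  have -> : 3 * n - 6 = 3 * (n - 2) by lia.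
  rewrite expnMn.
  have : 4 * ((n - 2) ^ 3) * (27 * (c * (c - 1) * (n + 1 - c))) <= 4 * ((n - 2) ^ 3) * (4 * (n + 1) ^ 3).
    by rewrite leq_mul2l amgm orbT.
  have : ((n - 2) * (n + 1)) ^ 3 <= (n * n) ^ 3 
    by rewrite leq_exp2r // mulnBl mulnDr muln1; lia.
  have : 16 * (n * n) ^ 3 <= n ^ 7.
    by rewrite mulnn -expnM (expnS n 6) leq_mul2r n16 orbT.
  rewrite [((n - 2) * _) ^ 3]expnMn; move: (c * _ * _) ((n - 2) ^ 3) ((n + 1) ^ 3) ((n * n) ^ 3) (n ^ 7) => Z1 Z2 Z3 Z4 Z5.
  clear; lia.
have {}ta : t <= minn n (2 * a) by rewrite leq_min tn ta.
have step : 4 * m ^ 3 * 'C(c, 2) * t <= 4 * (3 * n - 6) ^ 3 * 'C(c, 2) * minn n (2 * a).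
  by do 2 ?apply: leq_mul => //; rewrite leq_mul2l mM.
apply: leq_trans step _; move: ('C(c, 2)) b2 => b b2.
have cn : c <= 16 by lia.
(* The pair missing from the finite check needs the sharper bound [a <= 2]. *)
have [n8c6|n8c6] := boolP ((n == 8) && (c == 6)).
  move/andP: n8c6 => [/eqP ? /eqP ?]; subst n c.
  have a2 := n8 erefl erefl; have -> : b = 15 by lia.
  by move: a2; case: a {n8 acn ta} => [|[|[|]]] // _; lia.
have aM : minn n (2 * a) <= minn n (2 * (n + 1 - c)) by lia.
apply: leq_trans (_ : 4 * (3 * n - 6) ^ 3 * b * minn n (2 * (n + 1 - c)) <= _).
  by rewrite leq_mul2l aM orbT.
by apply: planar_count_small => //; rewrite ?n3 ?c2 //; lia.
Qed.

(** * From continuous to polygonal drawings *)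

From mathcomp Require Import all_classical all_reals all_analysis.
Import numFieldNormedType.Exports.

Local Open Scope ring_scope.

Lemma near_curve (R : realType) (f : R -> R * R) (s r : R) :
  {within `[(0:R), 1], continuous f}%classic -> 0 <= s <= 1 -> 0 < r ->
  exists2 d : R, 0 < d & forall s', 0 <= s' <= 1 -> `|s - s'| < d ->
    `|(f s).1 - (f s').1| < r /\ `|(f s).2 - (f s').2| < r.
Proof.
move=> /subspace_continuousP cf s01 r0.
have /cvg_ballP/(_ r r0) : (f x @[x --> within `[0, 1] (nbhs s)] --> f s)%classic.
  by apply: cf; rewrite /= in_itv.
move=> /nbhs_ballP[d /= d0 dP]; exists d => // s' s'01 ss'.
by have /(_ _)[] := dP s' ss'; rewrite /= ?in_itv.
Qed.

Lemma convex_near (R : realFieldType) (c a b l r : R) : 0 <= l <= 1 ->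
  `|c - a| < r -> `|c - b| < r -> `|c - (a + l * (b - a))| < r.
Proof.
rewrite !ltr_norml => /andP[]; rewrite le_eqVlt => /predU1P[<- _|l0 l1] /andP[? ?] /andP[? ?].
  by rewrite mul0r addr0; apply/andP.
by apply/andP; split; nra.
Qed.

Lemma segment_near (R : realType) (c a b q : R * R) (r : R) : segment a b q ->
  `|c.1 - a.1| < r /\ `|c.2 - a.2| < r -> `|c.1 - b.1| < r /\ `|c.2 - b.2| < r ->
  `|c.1 - q.1| < r /\ `|c.2 - q.2| < r.
Proof.
by case=> l l01 -> [a1 a2] [b1 b2]; split; exact: convex_near.
Qed.

(** Around each pair of parameters, short chords of the two curves stay in disjoint boxes;
    compactness of the parameter square makes the mesh uniform. *)
Lemma curves_separated (R : realType) (f g : R -> R * R) :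
  {within `[(0:R), 1], continuous f}%classic ->
  {within `[(0:R), 1], continuous g}%classic ->
  (forall s t : R, 0 <= s <= 1 -> 0 <= t <= 1 -> f s <> g t) ->
  (\forall n \near \oo, forall s s' t t' : R, 0 <= s <= 1 -> 0 <= s' <= 1 ->
    0 <= t <= 1 -> 0 <= t' <= 1 ->
    `|s - s'| <= n.+1%:R^-1 -> `|t - t'| <= n.+1%:R^-1 ->
    forall q, segment (f s) (f s') q -> ~ segment (g t) (g t') q)%classic.
Proof.
move=> cf cg fg.
pose P (n : nat) (x : R * R) : Prop := 0 <= x.1 <= 1 -> 0 <= x.2 <= 1 ->
  forall s' t' : R, 0 <= s' <= 1 -> 0 <= t' <= 1 ->
    `|x.1 - s'| <= n.+1%:R^-1 -> `|x.2 - t'| <= n.+1%:R^-1 ->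
    forall q, segment (f x.1) (f s') q -> ~ segment (g x.2) (g t') q.
have cpt : compact (`[(0:R), 1] `*` `[(0:R), 1])%classic.
  by apply: compact_setX; exact: segment_compact.
have /compact_near_coveringP/(_ nat (\oo)%classic P _) := cpt.
suff H : forall x, (`[(0:R), 1] `*` `[(0:R), 1])%classic x ->
    (\forall x' \near x & n \near \oo, P n x')%classic.
  move=> /(_ H); apply: filterS => n Pn s s' t t' s01 s'01 t01 t'01 ss' tt'.
  by apply: (Pn (s, t)) => //; split; rewrite /= in_itv.
move=> [s0 t0] [/=]; rewrite !in_itv /= => s01 t01.
(* The radius is half the gap in a coordinate where the two points differ. *)
have [r r0 far] : exists2 r, 0 < r & forall q,
    `|(f s0).1 - q.1| < r /\ `|(f s0).2 - q.2| < r ->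
    `|(g t0).1 - q.1| < r /\ `|(g t0).2 - q.2| < r -> False.
  have := fg s0 t0 s01 t01; case: (f s0) (g t0) => [a b] [c d] /= ne.
  have [/eqP ac|ac] := boolP (a == c); [have [/eqP bd|bd] := boolP (b == d)|].
  - by case: ne; rewrite ac bd.
  - exists (`|b - d| / 2); first by rewrite divr_gt0 // normr_gt0 subr_eq0.
    move=> q [_ h1] [_ h2]; have := ler_distD q.2 b d; rewrite [`|q.2 - d|]distrC; lra.
  - exists (`|a - c| / 2); first by rewrite divr_gt0 // normr_gt0 subr_eq0.
    move=> q [h1 _] [h2 _]; have := ler_distD q.1 a c; rewrite [`|q.1 - c|]distrC; lra.
have [d1 d10 near1] := near_curve cf s01 r0.
have [d2 d20 near2] := near_curve cg t01 r0.
(* Halving leaves room for two steps: from [s0] to the first end of a chord and on to its second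
   end, and likewise from [t0]. *)
pose d := Num.min d1 d2 / 2.
have d0 : 0 < d by rewrite divr_gt0 // lt_min d10.
have dd1 : d + d <= d1 by rewrite /d -splitr ge_min lexx.
have dd2 : d + d <= d2 by rewrite /d -splitr ge_min lexx orbT.
exists ([set x | `|s0 - x.1| < d /\ `|t0 - x.2| < d]%classic,
        [set n : nat | n.+1%:R^-1 < d]%classic).
  split=> /=; last first.
    by have := near_infty_natSinv_lt (PosNum d0).
  apply/nbhs_ballP; exists d => //= x [/= h1 h2]; split => //.
move=> [x n] /= [[xs xt] nd] x1 x2 s' t' s'01 t'01 hs ht q /segment_near fq /segment_near gq.
have le1 : d <= d1 by lra.
have le2 : d <= d2 by lra.
apply: (far q); [apply: fq|apply: gq].
- by apply: near1 => //; exact: lt_le_trans le1.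
- apply: near1 => //; apply: lt_le_trans dd1; apply: le_lt_trans (ler_distD x.1 _ _) _.
  by apply: ltrD => //; exact: le_lt_trans nd.
- by apply: near2 => //; exact: lt_le_trans le2.
- apply: near2 => //; apply: lt_le_trans dd2; apply: le_lt_trans (ler_distD x.2 _ _) _.
  by apply: ltrD => //; exact: le_lt_trans nd.
Qed.

(** The parameter 0 is left out, since a polygon carries its starting point separately. *)
Definition samples (R : realType) (f : R -> R * R) (n : nat) : seq (R * R) :=
  [seq f (i.+1%:R / n.+1%:R) | i <- iota 0 n.+1].

Lemma polygon_map (R : realType) (h : nat -> R * R) m k q :
  polygon (h m) [seq h i.+1 | i <- iota m k.+1] q ->
  exists2 i, (m <= i < m + k.+1)%N & segment (h i) (h i.+1) q.
Proof.
elim: k m => [|k IHk] m /=.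
  by case=> [mq|->]; exists m => //; [lia|lia|exact: segment_right].
case=> [mq|/(IHk m.+1)[i im iq]]; first by exists m => //; lia.
by exists i => //; lia.
Qed.

(** Arcs of vertex-disjoint edges are disjoint compact curves, so [curves_separated] keeps their
    sampled polygons disjoint once the mesh is fine enough. *)
Lemma planar_drawable (R : realType) (T : finType) (e : rel T) :
  planar R e -> drawable R [set: T] e.
Proof.
case=> p [f [pinj [fP fcross]]].
have ends x y (t : R) : e x y -> 0 <= t <= 1 ->
    [\/ f x y t = p x, f x y t = p y | 0 < t < 1].
  move=> /fP[f0 f1 _ _ _] /andP[]; rewrite !le_eqVlt.
  case/predU1P=> [<- _|t0]; first exact: Or31.
  by case/predU1P=> [->|t1]; [exact: Or32|apply: Or33; rewrite t0].
(* Interiors do not cross, interiors avoid vertices, and distinct vertices have distinct images;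
   together this covers closed arcs. *)
have dis x y u v (s t : R) : uniq [:: x; y; u; v] -> e x y -> e u v ->
    0 <= s <= 1 -> 0 <= t <= 1 -> f x y s <> f u v t.
  move=> U exy euv s01 t01.
  have [_ _ _ _ avxy] := fP x y exy; have [_ _ _ _ avuv] := fP u v euv.
  move: U; rewrite /= !inE !negb_or => /and4P[/and3P[_ xu xv] /andP[yu yv] _ _].
  have nep a b : a != b -> p a <> p b by move=> ab /pinj; apply/eqP.
  case: (ends _ _ _ exy s01) => [->|->|sI]; case: (ends _ _ _ euv t01) => [->|->|tI];
    try exact: nep; try exact: avxy; try by move=> E; exact: (avuv _ _ tI (esym E)).
  apply: fcross => //.
  by rewrite (negbTE xu) (negbTE xv).
have sep : (\forall n \near \oo, forall w : T * T * T * T,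
    let: (x, y, u, v) := w in uniq [:: x; y; u; v] -> e x y -> e u v ->
    forall s s' t t' : R, 0 <= s <= 1 -> 0 <= s' <= 1 -> 0 <= t <= 1 -> 0 <= t' <= 1 ->
    `|s - s'| <= n.+1%:R^-1 -> `|t - t'| <= n.+1%:R^-1 ->
    forall q, segment (f x y s) (f x y s') q -> ~ segment (f u v t) (f u v t') q)%classic.
  (* There are finitely many quadruples of vertices, so one mesh serves all of them. *)
  apply: filter_forall => -[[[x y] u] v].
  have [U|nU] := boolP (uniq [:: x; y; u; v]); last by apply: nearW => n /negP.
  have [exy|nexy] := boolP (e x y); last by apply: nearW.
  have [euv|neuv] := boolP (e u v); last by apply: nearW.
  have [_ _ cxy _ _] := fP x y exy; have [_ _ cuv _ _] := fP u v euv.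
  have := curves_separated cxy cuv (fun s t => dis x y u v s t U exy euv).
  by apply: filterS => n nP _ _ _.
have [n nP] := filter_ex sep.
exists p, (fun x y => samples (f x y) n); split; first by move=> x y _ _; exact: pinj.
  move=> x y _ _ exy; have [_ f1 _ _ _] := fP x y exy.
  rewrite /samples -addn1 iotaD map_cat last_cat /= add0n addn1 divff ?f1 //.
move=> x y u v _ U exy euv q.
have [f0 _ _ _ _] := fP x y exy; have [g0 _ _ _ _] := fP u v euv.
have h0 : (0 : R) = 0%:R / n.+1%:R by rewrite mul0r.
rewrite -f0 -g0 h0.
move=> /(polygon_map (h := fun i => f x y (i%:R / n.+1%:R)))[i /= iN iq].
move=> /(polygon_map (h := fun i => f u v (i%:R / n.+1%:R)))[j /= jN jq].
have itv k : (k <= n.+1)%N -> 0 <= (k%:R / n.+1%:R : R) <= 1.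
  by move=> kn; rewrite divr_ge0 //= ler_pdivrMr // mul1r ler_nat.
have mesh k : `|k%:R / n.+1%:R - k.+1%:R / n.+1%:R : R| <= n.+1%:R^-1.
  by rewrite -mulrBl -[k.+1]addn1 natrD opprD addrA subrr add0r mulN1r normrN ger0_norm.
apply: (nP (x, y, u, v) U exy euv _ _ _ _ _ _ _ _ (mesh i) (mesh j) q iq jq);
  by apply: itv; lia.
Qed.

(** * Counting bounds *)

Lemma planar_count (R : realType) (T : finType) (e : rel T) :
  symmetric e -> irreflexive e -> planar R e -> (1 <= nedges e)%N -> (2 <= chromatic_number e)%N ->
  (4 * nedges e ^ 3 * 'C(chromatic_number e, 2) * minn #|T| (2 * independence_number e)
     <= #|T| ^ 7)%N.
Proof.
move=> e_sym e_irr pl m1 c2; have dr := planar_drawable pl.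
have [S indS aS] := independence_attained e.
have [x0 _] : exists x : T, true.
  by move: m1; rewrite /nedges => /card_gt0P[E]; rewrite inE => /existsP[x _]; exists x.
have a1 := independence_ge1 e_irr x0.
have [s Ss] : exists s, s \in S by apply/set0Pn; rewrite -card_gt0 -aS.
have acn := chromatic_independent e_irr indS Ss.
have tn := geq_minl #|T| (2 * independence_number e).
have ta := geq_minr #|T| (2 * independence_number e).
have mE := darts_nedges e_sym e_irr.
(* The edge bound starts at three vertices; below that only a single edge on two vertices
   remains. *)
have [n3|n2] := leqP 3 #|T|; last first.
  have : (darts [set: T] e <= #|[set: T]| * #|[set: T]|.-1)%N.
    by apply: darts_le => x /(card_nbr_lt e_irr); case: #|[set: T]|.
  rewrite mE cardsT => mn.
  have [c2' n2'] : chromatic_number e = 2%N /\ #|T| = 2%N by lia.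
  have m1' : nedges e = 1%N by rewrite n2' in mn; lia.
  by rewrite n2' in tn *; rewrite m1' c2' binn; lia.
apply: (planar_count_le n3 _ c2 (a := independence_number e)) => //.
- by have := drawable_darts e_sym e_irr dr; rewrite mE cardsT; lia.
- by lia.
(* An independent set of size 3 would give equality in [acn]; then any two of the five other
   vertices are adjacent, which makes a K5. *)
move=> n8 c6; rewrite leqNgt; apply/negP => a3.
have S3 : #|S| = 3%N by lia.
have /negP : #|~: S|%SET != 5%N.
  apply: (drawable_K5_free _ _ dr); first exact: finset.subsetT.
  move=> u v; rewrite !inE => Su Sv uv; apply/negPn/negP => neuv.
  by have := chromatic_independent_lt e_sym e_irr indS Ss Su Sv uv neuv; lia.
by apply; apply/eqP; have := cardsC S; rewrite S3 n8; lia.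
Qed.

Lemma three_colorable_count (T : finType) (e : rel T) :
  symmetric e -> irreflexive e -> (chromatic_number e <= 3)%N -> (3 * nedges e <= #|T| ^ 2)%N.
Proof.
move=> e_sym e_irr c3; have [f fP] := chromatic_coloring e_irr.
have := @darts_3colorable T e (fun x => widen_ord c3 (f x)) fP.
by rewrite darts_nedges //; lia.
Qed.

Lemma nedges_le (T : finType) (e : rel T) :
  symmetric e -> irreflexive e -> (2 * nedges e <= #|T| ^ 2)%N.
Proof.
move=> e_sym e_irr; rewrite -darts_nedges // -mulnn -cardsT.
by apply: darts_le => x /(card_nbr_lt e_irr)/ltnW.
Qed.

(** * From natural numbers to the real inequality *)

Lemma thetaE (R : realType) (T : finType) (e : rel T) :
  theta R e = (minn #|T| (2 * independence_number e))%:R / 2.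
Proof.
rewrite /theta /nverts natr_min minr_pMl ?invr_ge0 ?ler0n //.
by rewrite natrM [2%:R * _]mulrC mulfK.
Qed.

(** With [t] for twice theta, clearing denominators leaves a factor [m] on both sides and an
    inequality between naturals. *)
Lemma quotient_bound (R : realType) (m b t n r : nat) :
  (0 < b)%N -> (0 < t)%N -> (0 < n)%N -> (0 < r)%N ->
  (2 ^ r * m ^ r.-1 * b * t <= r * n ^ (2 * r - 1))%N ->
  - (m%:R / (b%:R * (t%:R / 2))) <= - ((2 ^+ r.+1 * m%:R ^+ r) / (r%:R * n%:R ^+ (2 * r - 1))) :> R.
Proof.
move=> b0 t0 n0 r0 le; rewrite lerN2 ler_pdivrMr; last by rewrite mulr_gt0 ?exprn_gt0 ?ltr0n.
rewrite mulrAC ler_pdivlMr; last by rewrite !mulr_gt0 ?invr_gt0 ?ltr0n.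
have -> : 2 ^+ r.+1 * m%:R ^+ r * (b%:R * (t%:R / 2)) = m%:R * (2 ^ r * m ^ r.-1 * b * t)%:R :> R.
  by rewrite -[in m%:R ^+ r](prednK r0) !exprS !natrM !natrX; field.
by rewrite -natrX -[r%:R * _]natrM ler_wpM2l ?ler0n // ler_nat.
Qed.

Theorem theorem4p2 (R : realType) (T : finType) (e : rel T)
  (e_sym : symmetric e) (e_irr : irreflexive e) (r : nat) :
  (1 <= nedges e)%N ->
  ((r = 2%N \/ r = 3%N) /\ (chromatic_number e <= r)%N) \/ (r = 4%N /\ planar R e) ->
  - ((nedges e)%:R / ('C(chromatic_number e, 2)%:R * theta R e))
    <= - ((2 ^+ r.+1 * (nedges e)%:R ^+ r) / (r%:R * (nverts T)%:R ^+ (2 * r - 1))) :> R.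
Proof.
move=> m1 cases.
have [x [y exy]] : exists x y, e x y.
  move: m1 => /card_gt0P[E]; rewrite inE => /existsP[x /existsP[y /andP[exy _]]].
  by exists x, y.
have c2 := chromatic_ge2 e_irr exy.
have a1 := independence_ge1 e_irr x.
have n1 : (0 < #|T|)%N by apply/card_gt0P; exists x.
have tn := geq_minl #|T| (2 * independence_number e).
rewrite thetaE; apply: quotient_bound => //.
- by rewrite bin_gt0.
- by rewrite leq_min n1 muln_gt0.
- by case: cases => [[[]->]|[->]].
rewrite /nverts; case: cases => [[[]-> cr]|[-> pl]].
- have -> : chromatic_number e = 2%N by lia.
  have := nedges_le e_sym e_irr.
  move: (nedges e) (#|T|) (minn _ _) tn => m n t tn mn.
  have : (4 * m * t <= 2 * n ^ 2 * n)%N by apply: leq_mul => //; lia.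
  by rewrite /= !expnS expn0 binn; lia.
(* For [r = 3] the bounds [b <= 3] and [t <= n] leave $24m^2n$, and $9m^2 \le n^4$ bounds this by
   $\frac{24}{9}n^5 \le 3n^5$. *)
- have b3 : ('C(chromatic_number e, 2) <= 3)%N by rewrite (leq_trans (leq_bin2l 2 cr)).
  have := three_colorable_count e_sym e_irr cr.
  move: (nedges e) ('C(_, 2)) (#|T|) (minn _ _) tn b3 => m b n t tn b3 mn.
  have mm : ((3 * m) ^ 2 <= (n ^ 2) ^ 2)%N by rewrite leq_exp2r.
  have : (8 * m ^ 2 * b * t <= 8 * m ^ 2 * 3 * n)%N by rewrite !leq_mul.
  have : (9 * m ^ 2 * n <= (n ^ 2) ^ 2 * n)%N by rewrite leq_mul // -(expnMn 3 m 2).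
  by rewrite /= -[(2 * 3 - 1)%N]/5%N !expnS !expn0 !muln1; lia.
(* For [r = 4] the goal is [planar_count] multiplied by 4. *)
have := planar_count e_sym e_irr pl m1 c2.
by rewrite -(@leq_pmul2l 4) // !mulnA.
Qed.
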